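(* Let $R$ be a tolerance on a set $U$ induced by a finite irredundant covering $\mathcal{H}$ of $U$. Then the following assertions are equivalent: (i) $\mathcal{H}=\mathcal{B}(R)$. (ii) $\mathcal{H}$ is a normal covering. (iii) Whenever $B_1,B_2,B_3\in\mathcal{H}$ are such that the intersections $B_1\cap B_2$, $B_1\cap B_3$ and $B_2\cap B_3$ are nonempty, there exists $B\in\mathcal{H}$ that includes all three of these intersections. (iv) The Helly number of $(U,\lesssim_R)$ is $2$.
   Context: A tolerance on $U$ is a reflexive and symmetric binary relation on $U$; $R(x)=\{y\in U\mid x\,R\,y\}$. A covering of $U$ is a collection $\mathcal{H}$ of nonempty subsets of $U$ with $\bigcup\mathcal{H}=U$; it is irredundant if $\mathcal{H}\setminus\{X\}$ is not a covering of $U$ for any $X\in\mathcal{H}$. The tolerance induced by a covering $\mathcal{H}$ is $R_{\mathcal{H}}=\bigcup\{X^2\mid X\in\mathcal{H}\}$, where $X^2=X\times X$. A nonempty $X\subseteq U$ is an $R$-preblock if $X^2\subseteq R$; an $R$-block is an $R$-preblock maximal with respect to inclusion. $\mathcal{B}(R)$ is the set of all $R$-blocks. A covering $\mathcal{H}$ of $U$ is normal if: (N1) $\mathcal{H}$ is an antichain with respect to $\subseteq$; and (N2) if $M\subseteq U$ satisfies $M\nsubseteq B$ for all $B\in\mathcal{H}$, then there is at least one two-element set $\{a,b\}\subseteq M$ such that $\{a,b\}\nsubseteq B$ for all $B\in\mathcal{H}$. The quasiorder $\lesssim_R$ on $U$ is defined by $x\lesssim_R y$ if and only if $R(x)\subseteq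 R(y)$. A quasiordered set $(U,\lesssim)$ has Helly number $k$ if for every nonempty subset $A\subseteq U$: if any $k$ elements of $A$ have a common lower bound in $U$, then $A$ has a common lower bound in $U$ (no minimality of $k$ is required). In particular, the Helly number is $2$ if and only if every nonempty subset of $U$ in which any two elements have a common lower bound has a common lower bound. *)

(* Defs.v *)
From mathcomp Require Import all_boot.
From mathcomp Require Import boolp classical_sets cardinality.

Set Implicit Arguments.
Unset Strict Implicit.
Unset Printing Implicit Defensive.

Local Open Scope classical_set_scope.

(** Binary relations on [U] are subsets of [U * U]. *)

Definition tolerance (U : Type) (R : set (U * U)) : Prop :=
  (forall x, R (x, x)) /\ (forall x y, R (x, y) -> R (y, x)).

Definition nbhd (U : Type) (R : set (U * U)) (x : U) : set U :=
  [set y | R (x, y)].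

Definition covering (U : Type) (H : set (set U)) : Prop :=
  (forall X, H X -> X !=set0) /\ \bigcup_(X in H) X = setT.

Definition irredundant (U : Type) (H : set (set U)) : Prop :=
  forall X, H X -> ~ covering (H `\ X).

Definition induced_tolerance (U : Type) (H : set (set U)) : set (U * U) :=
  \bigcup_(X in H) (X `*` X).

Definition preblock (U : Type) (R : set (U * U)) (X : set U) : Prop :=
  X !=set0 /\ X `*` X `<=` R.

Definition blocks (U : Type) (R : set (U * U)) : set (set U) :=
  [set B | preblock R B /\ forall X, preblock R X -> B `<=` X -> X = B].

Definition antichain (U : Type) (H : set (set U)) : Prop :=
  forall X Y, H X -> H Y -> X `<=` Y -> X = Y.

(** For [M := set0], condition (N2) says that [H] is nonempty, so the empty type
    has no normal covering. *)
Definition normal_covering (U : Type) (H : set (set U)) : Prop :=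
  [/\ covering H,
      antichain H
    & forall M : set U, (forall B, H B -> ~ (M `<=` B)) ->
      exists a b : U, [/\ a <> b, [set a; b] `<=` M
        & forall B, H B -> ~ ([set a; b] `<=` B)]].

Definition tol_le (U : Type) (R : set (U * U)) (x y : U) : Prop :=
  nbhd R x `<=` nbhd R y.

Definition has_lower_bound (U : Type) (le : U -> U -> Prop) (A : set U) : Prop :=
  exists z, forall a, A a -> le z a.

(** The [k] elements [x 0, ..., x (k - 1)] may coincide, so that the hypothesis
    is not vacuous for a set [A] with fewer than [k] elements.  The number [k]
    need not be minimal. *)
Definition has_Helly_number (U : Type) (le : U -> U -> Prop) (k : nat) : Prop :=
  forall A : set U, A !=set0 ->
    (forall x : 'I_k -> U, (forall i, A (x i)) -> has_lower_bound le (range x)) ->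
    has_lower_bound le A.

(* Main.v *)
Require Import Defs.
From mathcomp Require Import all_boot.
From mathcomp Require Import boolp classical_sets cardinality.

(** Everything reduces to one property of the covering, [conformal]: each
    preblock of the induced tolerance lies in a member of [H].

    Irredundance gives each member [B] a private point [p], one that lies in no
    other member, so that the neighbourhood of [p] is exactly [B].  Two
    consequences follow.  Each member is a block, since the points of a preblock
    that includes it are all neighbours of [p] ([member_block]).  And [p] is below
    exactly the points of [B] in the quasiorder, so that a set has a common lower
    bound if and only if it is included in a member
    ([has_lower_bound_iff_sub_member]).  Two points thus have a common lower bound
    if and only if they are related, and Helly number 2 says precisely that [H] is
    conformal ([Helly2_iff_conformal]).

    If the members are all the blocks, [H] is conformal because preblocks extend
    to blocks, and for nonempty [M] the contrapositive of (N2) is conformality.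
    Applied to the union of the three pairwise intersections of [B1], [B2], [B3], whose points
    lie two by two in a common [Bi], (N2) gives condition (iii).  Condition (iii)
    gives conformality back by induction on the number of points, as in Gilmore's
    criterion for conformal hypergraphs ([conformal_of_triples]): a point removed
    from the family is recovered by comparing three different removals.  Finally,
    in a conformal covering a block lies in a member and hence equals it. *)

Local Open Scope classical_set_scope.

Definition conformal {U : Type} (H : set (set U)) : Prop :=
  forall X, preblock (induced_tolerance H) X -> exists2 B, H B & X `<=` B.

Lemma covering_member {U : Type} {H : set (set U)} (x : U) :
  covering H -> exists2 B, H B & B x.
Proof.
move=> [_ Hcov]; have : [set: U] x by [].
by rewrite -Hcov => -[B HB Bx]; exists B.
Qed.

(** * Members of an irredundant covering *)

Definition private_point {U : Type} (H : set (set U)) (B : set U) (p : U) : Prop :=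
  B p /\ forall C, H C -> C p -> C = B.

(** What a covering loses with [B] can only be points of [B], and such a lost
    point is private. *)
Lemma irredundant_private_point {U : Type} {H : set (set U)} {B : set U} :
  covering H -> irredundant H -> H B -> exists p, private_point H B p.
Proof.
move=> Hcov Hirr HB; apply: contrapT => nop; apply: (Hirr B HB); split.
  by move=> X [HX _]; apply: Hcov.1.
apply/seteqP; split=> // x _; apply: contrapT => xout.
have only C : H C -> C x -> C = B.
  by move=> HC Cx; apply: contrapT => CB; apply: xout; exists C.
apply: nop; exists x; split=> //.
by have [C HC Cx] := covering_member x Hcov; rewrite -(only C HC Cx).
Qed.

Lemma nbhd_private_point {U : Type} {H : set (set U)} {B : set U} {p : U} :
  H B -> private_point H B p -> nbhd (induced_tolerance H) p = B.
Proof.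
move=> HB [Bp only]; apply/seteqP; split=> [x [C HC [/= Cp Cx]]|x Bx].
  by rewrite -(only C HC Cp).
by exists B.
Qed.

Lemma member_preblock {U : Type} {H : set (set U)} {B : set U} :
  covering H -> H B -> preblock (induced_tolerance H) B.
Proof. by move=> Hcov HB; split=> [|xy Bxy]; [apply: Hcov.1|exists B]. Qed.

Lemma member_block {U : Type} {H : set (set U)} :
  covering H -> irredundant H -> H `<=` blocks (induced_tolerance H).
Proof.
move=> Hcov Hirr B HB; split; first exact: member_preblock.
move=> X [_ Xpre] BX; apply/seteqP; split=> // x Xx.
have [p pB] := irredundant_private_point Hcov Hirr HB.
rewrite -(nbhd_private_point HB pB); apply: Xpre; split=> //=.
exact: BX pB.1.
Qed.

(** * Helly number 2 *)

(** Every point is above the private point of each member through it, so lower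
    bounds may be sought among private points; and a point above the private
    point of [B] is related to it, hence lies in [B]. *)
Lemma has_lower_bound_iff_sub_member {U : Type} {H : set (set U)} (A : set U) :
  covering H -> irredundant H ->
  has_lower_bound (tol_le (induced_tolerance H)) A <->
    exists2 B, H B & A `<=` B.
Proof.
move=> Hcov Hirr; split=> [[z zA]|[B HB AB]].
  have [B HB Bz] := covering_member z Hcov; exists B => // a Aa.
  have [p [Bp only]] := irredundant_private_point Hcov Hirr HB.
  have [|C HC [/= Ca Cp]] := zA a Aa p; first by exists B.
  by rewrite -(only C HC Cp).
have [p pB] := irredundant_private_point Hcov Hirr HB.
exists p => a /AB Ba; rewrite /tol_le (nbhd_private_point HB pB) => x Bx.
by exists B.
Qed.

Lemma Helly2_iff_conformal {U : Type} {H : set (set U)} :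
  covering H -> irredundant H ->
  has_Helly_number (tol_le (induced_tolerance H)) 2 <-> conformal H.
Proof.
move=> Hcov Hirr; split=> [Helly X [X0 Xpre]|Hconf A A0 A2].
  apply/(has_lower_bound_iff_sub_member X Hcov Hirr); apply: Helly => // x xX.
  apply/(has_lower_bound_iff_sub_member _ Hcov Hirr).
  have [|B HB [/= B0 B1]] := Xpre (x ord0, x ord_max); first by split; apply: xX.
  exists B => // _ [[[|[|//]] i2] _ <-].
  - by rewrite (_ : Ordinal i2 = ord0) //; apply: val_inj.
  - by rewrite (_ : Ordinal i2 = ord_max) //; apply: val_inj.
apply/(has_lower_bound_iff_sub_member A Hcov Hirr); apply: Hconf; split=> //.
move=> [a b] [/= Aa Ab].
pose x (i : 'I_2) := if i == ord0 then a else b.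
have /(has_lower_bound_iff_sub_member _ Hcov Hirr)[B HB xB] :
    has_lower_bound (tol_le (induced_tolerance H)) (range x).
  by apply: A2 => i; rewrite /x; case: ifP.
by exists B => //; split; apply: xB; [exists ord0|exists ord_max].
Qed.

(** * Conformality from blocks and from triple intersections *)

(** Zorn's lemma.  The property to which it is applied must also hold of the
    empty set, the union of the empty chain; this is why [X] is adjoined to the
    sets under comparison instead of being required to be included in them. *)
Lemma preblock_sub_block {U : Type} {R : set (U * U)} {X : set U} :
  preblock R X -> exists2 B, blocks R B & X `<=` B.
Proof.
move=> [[x Xx] Xpre].
pose P (A : set U) := (A `|` X) `*` (A `|` X) `<=` R.
have [F FP Ftot|A [PA Amax]] := @Zorn_bigcup U P.
  move=> [a b] [/= [[C FC Ca]|Xa] [[D FD Db]|Xb]].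
  - have [CD|DC] := Ftot C D FC FD.
    + by apply: (FP D FD); split; left=> //; apply: CD.
    + by apply: (FP C FC); split; left=> //; apply: DC.
  - by apply: (FP C FC); split; [left|right].
  - by apply: (FP D FD); split; [right|left].
  - exact: Xpre.
exists (A `|` X); last by move=> y; right.
split; first by split=> //; exists x; right.
move=> Y [_ Ypre] AXY; apply/seteqP; split=> // y Yy.
left; apply: contrapT => nAy.
have XY : X `<=` Y by move=> z Xz; apply: AXY; right.
apply: (Amax Y); last by rewrite /P (setUidl XY).
by split; [move=> z Az; apply: AXY; left|move=> /(_ y Yy)].
Qed.

Section Triples.

Context {U : Type} {H : set (set U)} (Hcov : covering H).
Hypothesis Htriple : forall B1 B2 B3, H B1 -> H B2 -> H B3 ->
  B1 `&` B2 !=set0 -> B1 `&` B3 !=set0 -> B2 `&` B3 !=set0 ->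
  exists B, [/\ H B, B1 `&` B2 `<=` B, B1 `&` B3 `<=` B & B2 `&` B3 `<=` B].

(** Removing the points of index 0, 1 or 2 in turn leaves families included in
    members [B0], [B1], [B2].  Each index differs from at least two of 0, 1, 2,
    so each point lies in two of these members, hence in the member that
    condition (iii) provides. *)
Lemma related_family_sub_member (n : nat) (x : nat -> U) :
  (forall i j, i < n -> j < n -> induced_tolerance H (x i, x j)) ->
  exists2 B, H B & forall i, i < n -> B (x i).
Proof.
elim: n x => [|[|[|m]] IH] x xR.
- by have [B HB _] := covering_member (x 0) Hcov; exists B.
- have [B HB Bx] := covering_member (x 0) Hcov; exists B => //.
  by case.
- have [B HB [/= Bx0 Bx1]] := xR 0 1 isT isT; exists B => //.
  by case=> [|[]].
have removed h : h < m.+3 ->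
    exists2 B, H B & forall i, i < m.+3 -> i != h -> B (x i).
  move=> hm.
  have bumpm i : i < m.+2 -> bump h i < m.+3.
    by move=> im; rewrite /bump; case: (h <= i) => //; apply: leqW.
  have [|B HB Bx] := IH (x \o bump h).
    by move=> i j im jm; apply: xR; apply: bumpm.
  exists B => // i im ih; rewrite -(unbumpK (ih : i \in predC1 h)); apply: Bx.
  rewrite ltnS -leq_bump /bump; case: (leqP h) => // hm1.
  rewrite add0n -ltnS; apply: (@leq_trans h) => //.
  by rewrite ltn_neqAle ih; apply: leq_trans hm1.
have [B0 HB0 xB0] := removed 0 isT.
have [B1 HB1 xB1] := removed 1 isT.
have [B2 HB2 xB2] := removed 2 isT.
have [||| B [HB B01 B02 B12]] := Htriple _ _ _ HB0 HB1 HB2.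
- by exists (x 2); split; [apply: xB0|apply: xB1].
- by exists (x 1); split; [apply: xB0|apply: xB2].
- by exists (x 0); split; [apply: xB1|apply: xB2].
exists B => // -[|[|i]] im.
- by apply: B12; split; [apply: xB1|apply: xB2].
- by apply: B02; split; [apply: xB0|apply: xB2].
- by apply: B01; split; [apply: xB0|apply: xB1].
Qed.

(** A preblock included in no member would contain, for each of the finitely many
    members, a point outside it; these points are a finite related family. *)
Lemma conformal_of_triples : finite_set H -> conformal H.
Proof.
move=> /finite_seqP[s Hs] X [[x0 Xx0] Xpre]; apply: contrapT => Xout.
have escape C : exists y, X y /\ (H C -> ~ C y).
  have [HC|nHC] := pselect (H C); last by exists x0.
  apply: contrapT => noy; apply: Xout; exists C => // y Xy.
  by apply: contrapT => nCy; apply: noy; exists y.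
have [f fP] := choice escape.
have [i j _ _|B HB Bf] :=
    related_family_sub_member (size s) (fun i => f (nth set0 s i)).
  by apply: Xpre; split; apply: (fP _).1.
have Bs : B \in s by move: HB; rewrite Hs.
apply: ((fP B).2 HB).
by rewrite -{2}(nth_index set0 Bs); apply: Bf; rewrite index_mem.
Qed.

End Triples.

(** * The equivalence *)

Theorem proposition4p4 (U : Type) (R : set (U * U)) (H : set (set U))
    (U_nonempty : [set: U] !=set0)
    (R_tolerance : tolerance R)
    (H_finite : finite_set H)
    (H_covering : covering H)
    (H_irredundant : irredundant H)
    (R_induced : R = induced_tolerance H) :
  [<-> H = blocks R;
       normal_covering H;
       forall B1 B2 B3 : set U, H B1 -> H B2 -> H B3 ->
         B1 `&` B2 !=set0 -> B1 `&` B3 !=set0 -> B2 `&` B3 !=set0 ->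
         exists B : set U, [/\ H B, B1 `&` B2 `<=` B, B1 `&` B3 `<=` B
                             & B2 `&` B3 `<=` B];
       has_Helly_number (tol_le R) 2].
Proof.
subst R; tfae.
- move=> Hblocks; split=> //.
    move=> X Y HX HY XY; have [_ Xmax] := member_block H_covering H_irredundant _ HX.
    by rewrite (Xmax Y) //; apply: member_preblock.
  move=> M Mout; apply: contrapT => nopair.
  have [|B] := @preblock_sub_block U (induced_tolerance H) M; last first.
    by rewrite -Hblocks => /Mout.
  split.
    (* The empty set lies in every member, and there is one as [U] is nonempty. *)
    apply/set0P/eqP => M0; have [u _] := U_nonempty.
    by have [B HB _] := covering_member u H_covering; apply: (Mout B HB); rewrite M0.
  move=> [a b] [/= Ma Mb]; apply: contrapT => nab.
  apply: nopair; exists a, b; split.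
  + move=> ab; apply: nab; rewrite -ab.
    by have [B HB Ba] := covering_member a H_covering; exists B.
  + by move=> _ [->|->].
  + by move=> B HB abB; apply: nab; exists B => //; split; apply: abB; [left|right].
- move=> [_ _ N2] B1 B2 B3 HB1 HB2 HB3 _ _ _; apply: contrapT => noB.
  have [|a [b [_ abM about]]] := N2 (B1 `&` B2 `|` B1 `&` B3 `|` B2 `&` B3).
    move=> B HB MB; apply: noB; exists B; split=> // x Bx; apply: MB.
    + by left; left.
    + by left; right.
    + by right.
  have together C : H C -> C a -> C b -> False.
    by move=> HC Ca Cb; apply: (about C HC) => _ [->|->].
  (* Two of the three pairs of indices always have an index in common. *)
  have Ma := abM a (or_introl erefl); have Mb := abM b (or_intror erefl).
  move: (together _ HB1) (together _ HB2) (together _ HB3).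
  by move: Ma Mb => [[[]|[]]|[]] ? ? [[[]|[]]|[]]; tauto.
- move=> Htriple; apply/Helly2_iff_conformal => //.
  exact: conformal_of_triples.
- move=> /(Helly2_iff_conformal H_covering H_irredundant) Hconf.
  apply/seteqP; split; first exact: member_block.
  move=> X [Xpre Xmax]; have [B HB XB] := Hconf X Xpre.
  by rewrite -(Xmax B) //; apply: member_preblock.
Qed.
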